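(* Let $F$ be a graph with $\delta(F)\geqslant 1$. Then, for any $p=p(n)$ with $p\ll n^{-1/\mu(F)}$, $\mathrm{wsat}(\mathbb{G}(n,p),F)=e(\mathbb{G}(n,p))(1+o(1))$ with high probability. That is, for every $\varepsilon>0$, the probability that $|\mathrm{wsat}(\mathbb{G}(n,p),F)-e(\mathbb{G}(n,p))|\leqslant\varepsilon\, e(\mathbb{G}(n,p))$ tends to $1$ as $n\to\infty$.
   Context: All graphs are finite, undirected, without loops or multiple edges. $\delta(F)$ is the minimum degree of $F$. For a graph $G$, $m(G)=\max\{|E(H)|/|V(H)| : H \text{ is a subgraph of } G\}$ (over subgraphs with at least one vertex), and $\mu(G)=\max\{m(G),\,(|E(G)|-1)/(|V(G)|-2)\}$ if $|V(G)|\neq 2$, while $\mu(G)=m(G)$ if $|V(G)|=2$. For graphs $G$ and $F$, a graph $H$ is weakly $(G,F)$-saturated if $H$ is a spanning subgraph of $G$ which has no copy of $F$ as a (not necessarily induced) subgraph and there is an ordering $e_1,e_2,\dots$ of the edges in $E(G)\setminus E(H)$ such that for each $i$ the spanning subgraph of $G$ with edge set $E(H)\cup\{e_1,\dots,e_i\}$ has a copy of $F$ containing $e_i$. The weak saturation number $\mathrm{wsat}(G,F)$ is the minimum number of edges in a weakly $(G,F)$-saturated graph. $\mathbb{G}(n,p)$ is the Erdős–Rényi random graph on a fixed set of $n$ vertices, where every two distinct vertices are adjacent independently with probability $p=p(n)\in[0,1]$, and $e(\mathbb{G}(n,p))$ is its (random) number of edges. ''With high probability'' means with probability tending to $1$ as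 $n\to\infty$. $a(n)\ll b(n)$ means $a(n)/b(n)\to 0$ as $n\to\infty$. The graph $F$ is fixed (independent of $n$). *)

(* Defs.v *)
From HB Require Import structures.
From mathcomp Require Import all_boot all_order all_algebra.
From mathcomp Require Import all_classical all_reals all_analysis.
Import Order.TTheory GRing.Theory Num.Theory.
Import numFieldNormedType.Exports.

Set Implicit Arguments.
Unset Strict Implicit.
Unset Printing Implicit Defensive.

Local Open Scope ring_scope.

Definition vpairs (V : finType) : {set {set V}} := [set e : {set V} | #|e| == 2%N].

(* Finite simple graphs with vertex set V. *)
Record graph (V : finType) := Graph {
  edges : {set {set V}};
  edges_vpairs : edges \subset vpairs V }.

HB.instance Definition _ (V : finType) := [isSub for @edges V].
HB.instance Definition _ (V : finType) := [Finite of graph V by <:].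

Definition degree (V : finType) (G : graph V) (v : V) : nat :=
  #|[set e in edges G | v \in e]|.

(* All degrees are < #|V| when V is nonempty, so the default value #|V| only
   matters for the graph without vertices, to which it assigns 0. *)
Definition min_degree (V : finType) (G : graph V) : nat :=
  \big[minn/#|V|]_(v : V) degree G v.

Definition is_subgraph (V : finType) (W : {set V}) (D : {set {set V}})
    (G : graph V) : bool :=
  (D \subset edges G) && [forall e in D, e \subset W].

(* The ratios are nonnegative, so the default value 0 does not affect the
   maximum when V is nonempty. *)
Definition max_density (R : realType) (V : finType) (G : graph V) : R :=
  \big[Num.max/0]_(H : {set V} * {set {set V}} |
      (H.1 != finset.set0) && is_subgraph H.1 H.2 G)
    (#|H.2|%:R / #|H.1|%:R).

Definition mu (R : realType) (V : finType) (G : graph V) : R :=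
  if #|V| == 2%N then max_density R G
  else Num.max (max_density R G)
         ((#|edges G|%:R - 1) / (#|V|%:R - 2)).

Section Saturation.
Variables (VF V : finType) (F : graph VF).

Definition copy_edges (f : {ffun VF -> V}) : {set {set V}} :=
  [set f @: e | e : {set VF} in edges F].

Definition is_copy (f : {ffun VF -> V}) (D : {set {set V}}) : bool :=
  injectiveb f && (copy_edges f \subset D).

Definition has_copy (D : {set {set V}}) : bool :=
  [exists f : {ffun VF -> V}, is_copy f D].

Definition has_copy_through (D : {set {set V}}) (e : {set V}) : bool :=
  [exists f : {ffun VF -> V}, is_copy f D && (e \in copy_edges f)].

Definition weakly_saturated (G H : graph V) : Prop :=
  [/\ edges H \subset edges G,
      ~~ has_copy (edges H) &
      exists s : seq {set V},
        [/\ uniq s,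
            s =i edges G :\: edges H &
            forall i, (i < size s)%N ->
              has_copy_through (edges H :|: [set e in take i.+1 s])
                               (nth finset.set0 s i)]].

(* A weakly saturated H is a subgraph of G, so the default value #|edges G|
   is an upper bound of the values being minimised.  When F has an edge a
   weakly saturated H exists: delete from G, one at a time, edges lying in
   copies of F, until no copy is left. *)
Definition wsat (G : graph V) : nat :=
  \big[minn/#|edges G|]_(H : graph V | `[< weakly_saturated G H >])
    #|edges H|.

End Saturation.

Definition gnp_weight (R : realType) (n : nat) (p : R) (G : graph 'I_n) : R :=
  \prod_(e in vpairs 'I_n) (if e \in edges G then p else 1 - p).

Definition gnp_prob (R : realType) (n : nat) (p : R)
    (A : pred (graph 'I_n)) : R :=
  \sum_(G : graph 'I_n | A G) gnp_weight p G.

Definition much_less (R : realType) (a b : nat -> R) : Prop :=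
  ((fun n => a n / b n) @ \oo --> (0 : R))%classic.

(* Main.v *)
Require Import Defs.
From mathcomp Require Import all_boot all_order all_algebra.
From mathcomp Require Import all_classical all_reals all_analysis.
From mathcomp Require Import zify ring lra.
Import Order.TTheory GRing.Theory Num.Theory.
Import numFieldNormedType.Exports.
Local Open Scope ring_scope.

(** The deviation [e(G) - wsat(G, F)] is at most the number of copies of [F]
    in [G]: each edge added during the saturation process closes a copy of [F],
    and different steps close different copies ([weakly_saturated_card],
    [wsat_deviation]).  So it is enough that copies of [F] are, with high
    probability, either absent or negligible compared with the edges.  All moments
    needed come from one identity, that a fixed set [S] of potential edges is
    present with probability [p ^ |S|] ([gnp_expect_contains]).

    Suppose first that [mu F] is the maximum density, attained by a subgraph
    with [w] vertices and [d] edges.  The expected number of embeddings of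
    this subgraph is at most [n ^ w * p ^ d], which tends to [0] below the threshold
    [n ^ (- w / d)]; hence there is no copy of [F], and the deviation vanishes
    ([deviates_prob_subgraph]).

    Otherwise [mu F = (e - 1) / (v - 2)], where [F] has [v] vertices and [e] edges,
    and below the threshold [eta = n ^ (v - 2) * p ^ (e - 1)] tends to [0].
    The expected number of copies is at most [omega * eta] with
    [omega = n ^ 2 * p], which is the order of the expected number of edges.
    Two estimates are played against each other, since nothing is known
    about [omega].  If [omega] is bounded, then [omega * eta] tends to [0]
    and there is no copy of [F].  If [omega] is large, Chebyshev's inequality shows that
    the number of edges is at least half its mean, and Markov's inequality
    shows that the copies are few in comparison; this costs
    [O(1 / omega) + O(eta)] ([deviates_prob_dense]).  The cut between large and small
    [omega] is chosen in terms of the desired error probability alone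
    ([deviates_small]), so [p] may cross it back and forth as [n] grows. *)

Set Implicit Arguments.
Unset Strict Implicit.
Unset Printing Implicit Defensive.

(** * Moments in the random graph *)

Section RandomGraph.
Variables (R : realType) (n : nat) (p : R).

Definition gnp_expect (X : graph 'I_n -> R) : R :=
  \sum_(G : graph 'I_n) gnp_weight p G * X G.

Lemma gnp_expectD X Y :
  gnp_expect (fun G => X G + Y G) = gnp_expect X + gnp_expect Y.
Proof. by rewrite /gnp_expect -big_split; apply: eq_bigr => G _; rewrite mulrDr. Qed.

Lemma gnp_expectZ c X : gnp_expect (fun G => c * X G) = c * gnp_expect X.
Proof. by rewrite /gnp_expect mulr_sumr; apply: eq_bigr => G _; rewrite mulrCA. Qed.

Lemma gnp_expect_sum (I : finType) (P : pred I) (X : I -> graph 'I_n -> R) :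
  gnp_expect (fun G => \sum_(i | P i) X i G) = \sum_(i | P i) gnp_expect (X i).
Proof.
rewrite /gnp_expect exchange_big; apply: eq_bigr => G _.
by rewrite mulr_sumr.
Qed.

Lemma sum_graph (V : finType) (f : {set {set V}} -> R) :
  \sum_(G : graph V) f (edges G) = \sum_(E : {set {set V}} | E \subset vpairs V) f E.
Proof.
rewrite [RHS](reindex_omap (@edges V) insub) => [|E EV]; last by rewrite insubT.
by apply: eq_bigl => G; rewrite edges_vpairs valK eqxx.
Qed.

(** Expanding the product, over all pairs [e], of the total mass
    of the admissible states of [e] -- mass [p] for an element of [S],
    mass [p + (1 - p)] for another pair -- lists exactly the graphs
    that contain [S], each with its weight. *)
Lemma gnp_expect_contains (S : {set {set 'I_n}}) : S \subset vpairs 'I_n ->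
  gnp_expect (fun G => (S \subset edges G)%:R) = p ^+ #|S|.
Proof.
move=> SV.
pose a (e : {set 'I_n}) : R := if e \in vpairs 'I_n then p else 0.
pose b (e : {set 'I_n}) : R :=
  if e \in vpairs 'I_n then (if e \in S then 0 else 1 - p) else 1.
have <- : \prod_e (a e + b e) = p ^+ #|S|.
  rewrite -prodr_const [RHS]big_mkcond; apply: eq_bigr => e _; rewrite /a /b.
  have [/(fintype.subsetP SV) -> | _] := boolP (e \in S); first by rewrite addr0.
  by case: ifP => _; [rewrite addrC subrK | rewrite add0r].
rewrite bigA_distr /gnp_expect.
rewrite (sum_graph (fun E =>
  (\prod_(e in vpairs 'I_n) (if e \in E then p else 1 - p)) * (S \subset E)%:R)).
rewrite big_mkcond; apply: eq_bigr => E _.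
case: ifPn => [EV|]; last first.
  case/fintype.subsetPn => e eE eV.
  by rewrite (bigD1 e) //= eE /a (negPf eV) mul0r.
have [SE | /fintype.subsetPn[e eS eE]] := boolP (S \subset E); last first.
  by rewrite mulr0 (bigD1 e) //= (negPf eE) /b (fintype.subsetP SV _ eS) eS mul0r.
rewrite mulr1 big_mkcond; apply: eq_bigr => e _; rewrite /a /b.
case: ifP => eV.
  case: ifP => // eE; case: ifP => // eS.
  by rewrite (fintype.subsetP SE _ eS) in eE.
by case: ifP => // /(fintype.subsetP EV); rewrite eV.
Qed.

Lemma gnp_expect1 : gnp_expect (fun=> 1) = 1.
Proof.
rewrite -[RHS](expr0 p) -[in RHS](cards0 {set 'I_n}).
rewrite -gnp_expect_contains ?finset.sub0set //.
by apply: eq_bigr => G _; rewrite finset.sub0set.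
Qed.

Lemma gnp_probC (A : pred (graph 'I_n)) : gnp_prob p A = 1 - gnp_prob p (predC A).
Proof.
suff <- : gnp_prob p A + gnp_prob p (predC A) = 1 by rewrite addrK.
rewrite -gnp_expect1 /gnp_expect [RHS](bigID A) /=.
by congr (_ + _); apply: eq_bigr => G _; rewrite mulr1.
Qed.

Hypothesis p01 : 0 <= p <= 1.

Lemma gnp_weight_ge0 (G : graph 'I_n) : 0 <= gnp_weight p G.
Proof.
case/andP: p01 => p0 p1; apply: prodr_ge0 => e _.
by case: ifP => // _; rewrite subr_ge0.
Qed.

Lemma gnp_prob_ge0 (A : pred (graph 'I_n)) : 0 <= gnp_prob p A.
Proof. by apply: sumr_ge0 => G _; exact: gnp_weight_ge0. Qed.

(** Markov's inequality, with the threshold normalised to [1]. *)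
Lemma gnp_markov (A : pred (graph 'I_n)) (X : graph 'I_n -> R) :
  (forall G, 0 <= X G) -> (forall G, A G -> 1 <= X G) ->
  gnp_prob p A <= gnp_expect X.
Proof.
move=> X0 AX; rewrite /gnp_prob big_mkcond; apply: ler_sum => G _.
have w0 := gnp_weight_ge0 G.
by case: ifP => [/AX|_]; [exact: ler_peMr | exact: mulr_ge0].
Qed.

Local Notation N := (#|vpairs 'I_n|%:R : R).

Lemma edge_count (G : graph 'I_n) :
  #|edges G|%:R = \sum_(e in vpairs 'I_n) ([set e] \subset edges G)%:R :> R.
Proof.
rewrite -sum1_card natr_sum big_mkcond [RHS]big_mkcond; apply: eq_bigr => e _.
rewrite finset.sub1set; case: ifP => [/(fintype.subsetP (edges_vpairs G)) -> //|_].
by case: ifP.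
Qed.

Lemma gnp_expect_edges : gnp_expect (fun G => #|edges G|%:R) = N * p.
Proof.
transitivity (\sum_(e in vpairs 'I_n) p); last by rewrite sumr_const mulr_natl.
under [LHS]eq_bigr do rewrite edge_count.
rewrite -/(gnp_expect _) gnp_expect_sum; apply: eq_bigr => e eV.
by rewrite gnp_expect_contains ?cards1 ?expr1 // finset.sub1set.
Qed.

(** The second moment sums [p ^ |{a, b}|] over ordered pairs of potential edges;
    the diagonal contributes [N * p] and the rest at most the square of the mean. *)
Lemma gnp_edges_variance :
  gnp_expect (fun G => (#|edges G|%:R - N * p) ^+ 2) <= N * p.
Proof.
have p0 : 0 <= p by case/andP: p01.
have second : gnp_expect (fun G => #|edges G|%:R ^+ 2) <= N * p + (N * p) ^+ 2.
  have -> : gnp_expect (fun G => #|edges G|%:R ^+ 2) =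
     \sum_(a in vpairs 'I_n) \sum_(b in vpairs 'I_n) p ^+ #|[set a; b]|.
    transitivity (gnp_expect (fun G => \sum_(a in vpairs 'I_n)
      \sum_(b in vpairs 'I_n) ([set a; b] \subset edges G)%:R)).
      apply: eq_bigr => G _; congr (_ * _).
      rewrite expr2 {1}edge_count mulr_suml; apply: eq_bigr => a _.
      rewrite edge_count mulr_sumr; apply: eq_bigr => b _.
      by rewrite finset.subUset -natrM mulnb.
    rewrite gnp_expect_sum; apply: eq_bigr => a aV.
    rewrite gnp_expect_sum; apply: eq_bigr => b bV.
    by rewrite gnp_expect_contains // finset.subUset !finset.sub1set aV.
  have -> : N * p + (N * p) ^+ 2 = \sum_(a in vpairs 'I_n) (p + N * p ^+ 2).
    by rewrite sumr_const -mulr_natl; ring.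
  apply: ler_sum => a aV.
  rewrite (bigD1 a) //= finset.setUid cards1 expr1 lerD2l.
  rewrite mulr_natl -sumr_const big_mkcond [X in _ <= X]big_mkcond.
  apply: ler_sum => b _; rewrite cards2.
  case: (b \in vpairs 'I_n) => //=; rewrite eq_sym.
  by case: eqP => //= _; rewrite exprn_ge0.
have -> : gnp_expect (fun G => (#|edges G|%:R - N * p) ^+ 2) =
    gnp_expect (fun G => #|edges G|%:R ^+ 2) - (N * p) ^+ 2.
  transitivity (gnp_expect (fun G => (#|edges G|%:R ^+ 2
      + (- 2 * (N * p)) * #|edges G|%:R) + (N * p) ^+ 2 * 1)).
    by apply: eq_bigr => G _; congr (_ * _); ring.
  rewrite !gnp_expectD !gnp_expectZ gnp_expect_edges gnp_expect1; ring.
by rewrite lerBlDr.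
Qed.

End RandomGraph.

(** * Weak saturation and copies *)

Section Copies.
Variables (VF V : finType) (F : graph VF).

Definition copies (D : {set {set V}}) : {set {ffun VF -> V}} :=
  [set f | is_copy F f D].

(** When [e] is added at step [i] it lies in a copy that uses only edges present
    at step [i].  Copies chosen at different steps differ, because the later of
    the two added edges is absent from the earlier copy; so the process has at most
    as many steps as there are copies. *)
Lemma weakly_saturated_card (G H : graph V) : weakly_saturated F G H ->
  (#|edges G| <= #|edges H| + #|copies (edges G)|)%N.
Proof.
case=> HG _ [s [us sE hs]].
have sGH e : (e \in s) = (e \notin edges H) && (e \in edges G).
  by rewrite sE finset.in_setD.
have size_s : size s = (#|edges G| - #|edges H|)%N.
  by rewrite -(card_uniqP us) (eq_card sE) cardsD (finset.setIidPr HG).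
rewrite -leq_subLR -size_s.
have step (i : 'I_(size s)) : {f : {ffun VF -> V} |
    is_copy F f (edges H :|: [set e in take i.+1 s]) &
    nth finset.set0 s i \in copy_edges F f}.
  have /existsP/sigW[f /andP[]] := hs i (ltn_ord i).
  by exists f.
pose g i := s2val (step i).
have copy_g (i : 'I_(size s)) : is_copy F (g i) (edges H :|: [set e in take i.+1 s]).
  exact: s2valP (step i).
have mem_g (i : 'I_(size s)) : nth finset.set0 s i \in copy_edges F (g i).
  exact: s2valP' (step i).
have later (i j : 'I_(size s)) : (i < j)%N -> g i <> g j.
  move=> ij gij; case/andP: (copy_g i) => _ /fintype.subsetP/(_ (nth finset.set0 s j)).
  rewrite gij => /(_ (mem_g j)); rewrite finset.in_setU finset.inE.
  have /[!sGH]/andP[/negPf-> _] := mem_nth finset.set0 (ltn_ord j).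
  move=> /= /(nthP finset.set0)[k]; rewrite size_take_min => kmin.
  have ki : (k < i.+1)%N by apply: leq_trans kmin (geq_minl _ _).
  have ks : (k < size s)%N by apply: leq_trans kmin (geq_minr _ _).
  rewrite nth_take // => /eqP; rewrite nth_uniq // => /eqP kj.
  by rewrite kj ltnS leqNgt ij in ki.
have g_inj : injective g.
  move=> i j gij; apply: val_inj.
  by case: (ltngtP i j) => // [/later|/later /nesym].
rewrite -[leqLHS]card_ord -(card_imset _ g_inj) subset_leq_card //.
apply/fintype.subsetP => _ /imsetP[i _ ->]; rewrite finset.inE /is_copy.
case/andP: (copy_g i) => -> /= gi_sub; apply: fintype.subset_trans gi_sub _.
rewrite finset.subUset HG; apply/fintype.subsetP => e; rewrite finset.inE.
by move/mem_take; rewrite sGH => /andP[].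
Qed.

Lemma wsat_deviation (R : realType) (G : graph V) :
  `|(wsat F G)%:R - #|edges G|%:R| <= #|copies (edges G)|%:R :> R.
Proof.
have wsat_le : (wsat F G <= #|edges G|)%N.
  rewrite /wsat; apply: (big_ind (fun x => x <= #|edges G|)%N) => //.
    by move=> x y xG _; rewrite geq_min xG.
  by move=> H /asboolP[HG _ _]; exact: subset_leq_card.
have le_wsat : (#|edges G| <= wsat F G + #|copies (edges G)|)%N.
  rewrite /wsat; apply: (big_ind (fun x => #|edges G| <= x + #|copies (edges G)|)%N).
  - exact: leq_addr.
  - by move=> x y; rewrite /minn; case: ifP.
  - by move=> H /asboolP; exact: weakly_saturated_card.
rewrite distrC ger0_norm ?subr_ge0 ?ler_nat //.
by rewrite lerBlDl -natrD ler_nat.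
Qed.

(** Maps defined on a vertex set [W] are encoded as total maps by giving the
    vertices outside [W] the fixed value [x0]; there are [#|V| ^ #|W|] of them. *)
Definition embeddings (x0 : V) (W : {set VF}) (D : {set {set VF}})
    (E : {set {set V}}) : {set {ffun VF -> V}} :=
  [set f in pffun_on x0 W predT |
    dinjectiveb f W && ([set f @: e | e : {set VF} in D] \subset E)].

(** Restricting a copy of [F] to [W] embeds the subgraph [(W, D)], so sparse
    expected embeddings of any one subgraph already exclude [F]. *)
Lemma embeddings_of_copies (x0 : V) (W : {set VF}) (D : {set {set VF}})
    (E : {set {set V}}) :
  is_subgraph W D F -> (0 < #|copies E|)%N -> (0 < #|embeddings x0 W D E|)%N.
Proof.
case/andP=> DF /forall_inP DW /card_gt0P[f].
rewrite finset.inE => /andP[/injectiveP f_inj fE].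
pose g := [ffun x => if x \in W then f x else x0].
have gE x : x \in W -> g x = f x by rewrite ffunE => ->.
apply/card_gt0P; exists g; rewrite finset.inE; apply/and3P; split.
- apply/pffun_onP; split=> //; apply/fintype.subsetP => x.
  by rewrite !inE ffunE; case: ifP => // _; rewrite eqxx.
- by apply/dinjectiveP => x y xW yW; rewrite !gE //; exact: f_inj.
- apply/fintype.subsetP => _ /imsetP[e eD ->].
  have -> : g @: e = f @: e.
    by apply: eq_in_imset => x /(fintype.subsetP (DW e eD)); exact: gE.
  by apply: (fintype.subsetP fE); apply: imset_f; exact: (fintype.subsetP DF).
Qed.

Lemma copies_le_embeddings (x0 : V) (E : {set {set V}}) :
  (#|copies E| <= #|embeddings x0 finset.setT (edges F) E|)%N.
Proof.
apply: subset_leq_card; apply/fintype.subsetP => f.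
rewrite !finset.inE => /andP[/injectiveP f_inj fE].
apply/and3P; split=> //.
- by apply/pffun_onP; split=> //; apply/fintype.subsetP => x; rewrite finset.in_setT.
- by apply/dinjectiveP => x y _ _; exact: f_inj.
Qed.

Lemma is_subgraph_full : is_subgraph finset.setT (edges F) F.
Proof.
rewrite /is_subgraph fintype.subxx; apply/forall_inP => e _.
exact: finset.subsetT.
Qed.

Lemma card_imset_edges (W : {set VF}) (D : {set {set VF}}) (f : {ffun VF -> V}) :
  is_subgraph W D F -> {in W &, injective f} ->
  #|[set f @: e | e : {set VF} in D]| = #|D|.
Proof.
case/andP=> _ /forall_inP DW f_inj; apply: card_in_imset.
suff sub (d e : {set VF}) : d \in D -> e \in D -> f @: d = f @: e -> d \subset e.
  by move=> d e dD eD de; apply/eqP; rewrite finset.eqEsubset !sub.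
move=> dD eD de; apply/fintype.subsetP => x xd.
have : f x \in f @: e by rewrite -de imset_f.
case/imsetP=> y ye fxy.
suff -> : x = y by [].
by apply: f_inj fxy; [exact: (fintype.subsetP (DW d dD)) |
                      exact: (fintype.subsetP (DW e eD))].
Qed.

Lemma imset_edges_vpairs (W : {set VF}) (D : {set {set VF}}) (f : {ffun VF -> V}) :
  is_subgraph W D F -> {in W &, injective f} ->
  [set f @: e | e : {set VF} in D] \subset vpairs V.
Proof.
case/andP=> DF /forall_inP DW f_inj; apply/fintype.subsetP => _ /imsetP[e eD ->].
rewrite finset.inE card_in_imset => [|x y xe ye]; last first.
  by apply: f_inj; apply: (fintype.subsetP (DW e eD)).
have := fintype.subsetP (edges_vpairs F) e (fintype.subsetP DF e eD).
by rewrite finset.inE.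
Qed.

End Copies.

(** Each of the at most [n ^ |W|] injections sends [D] to [|D|] distinct pairs,
    all present with probability [p ^ |D|]. *)
Lemma expected_embeddings (R : realType) (n : nat) (p : R) (VF : finType)
    (F : graph VF) (x0 : 'I_n) (W : {set VF}) (D : {set {set VF}}) :
  0 <= p <= 1 -> is_subgraph W D F ->
  gnp_expect p (fun G => #|embeddings x0 W D (edges G)|%:R)
    <= n%:R ^+ #|W| * p ^+ #|D|.
Proof.
move=> /andP[p0 p1] WD.
pose A := [set f in pffun_on x0 W predT | dinjectiveb f W].
have -> : gnp_expect p (fun G => #|embeddings x0 W D (edges G)|%:R) =
    gnp_expect p (fun G => \sum_(f in A)
      ([set f @: e | e : {set VF} in D] \subset edges G)%:R).
  apply: eq_bigr => G _; congr (_ * _).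
  rewrite -sum1_card natr_sum big_mkcond [RHS]big_mkcond; apply: eq_bigr => f _.
  by rewrite !finset.in_set andbA; case: (_ && dinjectiveb _ _) => //=; case: ifP.
rewrite gnp_expect_sum (eq_bigr (fun=> p ^+ #|D|)) => [|f]; last first.
  rewrite finset.inE => /andP[_ /dinjectiveP f_inj].
  by rewrite gnp_expect_contains ?(imset_edges_vpairs WD) // (card_imset_edges WD).
rewrite sumr_const -[leLHS]mulr_natl -natrX ler_wpM2r ?exprn_ge0 // ler_nat.
have <- : #|pffun_on x0 W predT| = (n ^ #|W|)%N.
  by rewrite card_pffun_on card_ord.
by apply: subset_leq_card; apply/fintype.subsetP => f; rewrite finset.inE => /andP[].
Qed.

(** * Below the threshold *)

(** With [c = 1] the bound on [p] says exactly that [n ^ a * p ^ b <= 1]; the factor [c]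
    then gains [c ^ b], hence at least [c]. *)
Lemma expn_threshold (R : realType) (n a b : nat) (p c : R) :
  (0 < n)%N -> (0 < a)%N -> (0 < b)%N -> 0 <= p -> 0 <= c <= 1 ->
  p <= c * n%:R `^ (- (b%:R / a%:R)^-1) -> n%:R ^+ a * p ^+ b <= c.
Proof.
move=> n0 a0 b0 p0 /andP[c0 c1] pc.
have nR : 0 < n%:R :> R by rewrite ltr0n.
have threshold : (n%:R `^ (- (b%:R / a%:R)^-1)) ^+ b = (n%:R ^+ a)^-1 :> R.
  rewrite -powR_mulrn ?powR_ge0 // -powRrM mulNr invf_div divfK ?pnatr_eq0 -?lt0n //.
  by rewrite powRN powR_mulrn // ltW.
have pb : p ^+ b <= c ^+ b * (n%:R ^+ a)^-1.
  rewrite -threshold -exprMn; apply: lerXn2r => //; rewrite nnegrE //.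
  exact: le_trans pc.
rewrite mulrC -ler_pdivlMr ?exprn_gt0 //.
apply: (le_trans pb); rewrite ler_wpM2r ?invr_ge0 ?exprn_ge0 //.
by rewrite -(prednK b0) exprS ler_piMr // exprn_ile1.
Qed.

Lemma card_vpairs_ge (R : realType) (n : nat) :
  (2 <= n)%N -> n%:R ^+ 2 / 4 <= #|vpairs 'I_n|%:R :> R.
Proof.
move=> n2; rewrite ler_pdivrMr // -natrX -natrM ler_nat.
rewrite /vpairs card_draws card_ord.
have : ('C(n, 2) * 2 = n * n.-1)%N by rewrite mulnC -mul_bin_diag bin1.
case: n n2 => [|[|n]] // _ /=; nia.
Qed.

Lemma edges_gt0 (VF : finType) (F : graph VF) :
  (1 <= min_degree F)%N -> (0 < #|edges F|)%N.
Proof.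
case: (pickP (predT : pred VF)) => [v _ hF|VF0]; last first.
  by rewrite /min_degree big_pred0 ?(eq_card0 VF0).
have : (1 <= degree F v)%N.
  apply: leq_trans hF _.
  exact: (@bigmin_le_cond _ nat _ #|VF| v predT (degree F)).
move=> /leq_trans; apply; apply: subset_leq_card.
by apply/fintype.subsetP => e; rewrite finset.inE => /andP[].
Qed.

Section Deviation.
Variables (R : realType) (VF : finType) (F : graph VF) (eps : R).
Hypothesis eps0 : 0 < eps.

Definition deviates (n : nat) (G : graph 'I_n) : bool :=
  ~~ (`|(wsat F G)%:R - #|edges G|%:R| <= eps * #|edges G|%:R).

Lemma deviates_copies (n : nat) (G : graph 'I_n) :
  deviates G -> eps * #|edges G|%:R < #|copies F (edges G)|%:R.
Proof. by rewrite /deviates -ltNge => /lt_le_trans; apply; exact: wsat_deviation. Qed.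

Lemma deviates_has_copy (n : nat) (G : graph 'I_n) :
  deviates G -> (0 < #|copies F (edges G)|)%N.
Proof.
move/deviates_copies/(le_lt_trans _); rewrite -(ltr0n R); apply.
by rewrite mulr_ge0 // ltW.
Qed.

(** A deviation forces a copy of [F], hence an embedding of each of its subgraphs. *)
Lemma deviates_prob_subgraph (n : nat) (p : R) (W : {set VF}) (D : {set {set VF}}) :
  (0 < n)%N -> 0 <= p <= 1 -> is_subgraph W D F ->
  gnp_prob p (@deviates n) <= n%:R ^+ #|W| * p ^+ #|D|.
Proof.
case: n => // n _ p01 WD; apply: le_trans (expected_embeddings ord0 p01 WD).
apply: gnp_markov => // G /deviates_has_copy /(embeddings_of_copies ord0 WD).
by rewrite -(ler_nat R).
Qed.

(** A deviation requires either fewer than half the expected number of edges or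
    at least [eps / 2] copies per expected edge.  Both alternatives are
    charged to a single nonnegative random variable [Y]: a scaled squared deviation
    of the number of edges plus a scaled number of copies. *)
Lemma deviates_prob_dense (n : nat) (p : R) :
  (2 <= n)%N -> 0 <= p <= 1 -> 0 < p ->
  gnp_prob p (@deviates n) <=
    16 / (n%:R ^+ 2 * p)
    + 8 / eps * (n%:R ^+ #|VF| * p ^+ #|edges F|) / (n%:R ^+ 2 * p).
Proof.
case: n => // n n2 p01 p0.
pose w : R := n.+1%:R ^+ 2 * p; pose M : R := #|vpairs 'I_n.+1|%:R * p.
have w0 : 0 < w by rewrite mulr_gt0 // exprn_gt0.
have wM : w / 4 <= M by rewrite /w mulrAC ler_pM2r //; exact: card_vpairs_ge.
have M0 : 0 < M by apply: lt_le_trans wM; rewrite divr_gt0.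
have FF := is_subgraph_full F.
pose X (G : graph 'I_n.+1) : R := #|embeddings ord0 finset.setT (edges F) (edges G)|%:R.
have X0 G : 0 <= X G by [].
pose Y (G : graph 'I_n.+1) :=
  4 / M ^+ 2 * (#|edges G|%:R - M) ^+ 2 + 2 / (eps * M) * X G.
have c1 : 0 <= 4 / M ^+ 2 by rewrite divr_ge0 // exprn_ge0 // ltW.
have c2 : 0 <= 2 / (eps * M) by rewrite divr_ge0 // mulr_ge0 // ltW.
have devY G : deviates G -> 1 <= Y G.
  move=> /deviates_copies devG.
  have XG : eps * #|edges G|%:R <= X G.
    by apply: le_trans (ltW devG) _; rewrite ler_nat copies_le_embeddings.
  have [few|many] := leP (#|edges G|%:R) (M / 2).
    apply: ler_wpDr; first exact: mulr_ge0.
    by rewrite mulrAC ler_pdivlMr ?exprn_gt0 // mul1r; nra.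
  apply: ler_wpDl; first by rewrite (mulr_ge0 c1) // sqr_ge0.
  rewrite mulrAC ler_pdivlMr; last exact: mulr_gt0.
  have : eps * (M / 2) <= eps * #|edges G|%:R by rewrite ler_pM2l // ltW.
  lra.
have Y0 G : 0 <= Y G.
  by rewrite addr_ge0 // mulr_ge0 // sqr_ge0.
apply: (le_trans (gnp_markov p01 Y0 devY)).
rewrite gnp_expectD !gnp_expectZ -/w.
have EX : gnp_expect p X <= n.+1%:R ^+ #|VF| * p ^+ #|edges F|.
  by have := expected_embeddings (ord0 : 'I_n.+1) p01 FF; rewrite finset.cardsT.
have EX0 : 0 <= n.+1%:R ^+ #|VF| * p ^+ #|edges F|.
  by rewrite mulr_ge0 ?exprn_ge0 // ltW.
move: (n.+1%:R ^+ #|VF| * p ^+ #|edges F|) EX EX0 => T EX EX0.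
have Mw : M^-1 <= 4 / w.
  by rewrite -[4 / w]invf_div lef_pV2 // posrE divr_gt0.
apply: lerD.
  apply: (@le_trans _ _ (4 / M ^+ 2 * M)).
    rewrite ler_pM2l ?divr_gt0 ?exprn_gt0 //; exact: gnp_edges_variance.
  have -> : 4 / M ^+ 2 * M = 4 * M^-1 by field; rewrite gt_eqF.
  have -> : 16 / w = 4 * (4 / w) by field; rewrite gt_eqF.
  by rewrite ler_pM2l.
have -> : 2 / (eps * M) * gnp_expect p X = 2 / eps * gnp_expect p X * M^-1.
  by field; rewrite !gt_eqF.
have -> : 8 / eps * T / w = 2 / eps * T * (4 / w) by field; rewrite !gt_eqF.
apply: ler_pM => //.
- by rewrite mulr_ge0 ?divr_ge0 // ?(ltW eps0) // sumr_ge0 // => G _;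
     rewrite mulr_ge0 // gnp_weight_ge0.
- by rewrite invr_ge0 ltW.
- by rewrite ler_pM2l // divr_gt0.
Qed.

Hypothesis F1 : (0 < #|edges F|)%N.

(** The maximum is positive since [F] has an edge, so it is not the default value [0]
    of the iterated maximum and the densest subgraph has an edge. *)
Lemma max_density_attained : exists H : {set VF} * {set {set VF}},
  [/\ is_subgraph H.1 H.2 F, (0 < #|H.1|)%N, (0 < #|H.2|)%N &
      max_density R F = #|H.2|%:R / #|H.1|%:R].
Proof.
have [e eF] := card_gt0P F1.
have [v _] : exists v, v \in e.
  apply/card_gt0P; have := fintype.subsetP (edges_vpairs F) e eF.
  by rewrite finset.inE => /eqP ->.
pose FF := (finset.setT, edges F) : {set VF} * {set {set VF}}.
pose P (H : {set VF} * {set {set VF}}) := (H.1 != finset.set0) && is_subgraph H.1 H.2 F.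
pose d (H : {set VF} * {set {set VF}}) : R := #|H.2|%:R / #|H.1|%:R.
have PF : P FF.
  rewrite /P is_subgraph_full andbT.
  by apply/finset.set0Pn; exists v.
have dF : 0 < d FF.
  by rewrite divr_gt0 // ltr0n //= finset.cardsT; apply/card_gt0P; exists v.
have d_ge0 H : P H -> 0 <= d H by move=> _; rewrite divr_ge0.
have [H PH maxH] := @eq_bigmax _ R _ 0 FF P d PF d_ge0.
have : 0 < d H.
  by apply: lt_le_trans dF _; rewrite -maxH; exact: le_bigmax_cond.
case/andP: PH => H0 Hsub dH; exists H; split => //.
- by rewrite card_gt0.
- by move: dH; rewrite /d; case: #|H.2| => //; rewrite mul0r ltxx.
Qed.

(** The error probability is controlled by a smallness constant [c] that depends
    neither on [n] nor on [p]; this uniformity is what turns the hypothesis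
    [p << n ^ (- 1 / mu)] directly into convergence. *)
Lemma deviates_small (delta : R) : 0 < delta -> exists2 c : R, 0 < c &
  forall (n : nat) (p : R), (2 <= n)%N -> 0 <= p <= 1 ->
    p <= c * n%:R `^ (- (mu R F)^-1) -> gnp_prob p (@deviates n) <= delta.
Proof.
move=> delta0.
have [[W D] /= [WD W0 D0 mE]] := max_density_attained.
have m0 : 0 < max_density R F by rewrite mE divr_gt0 // ltr0n.
have FF := is_subgraph_full F.
(* If the second term of the maximum wins, it is positive; as [F] has an edge and
   [#|VF| != 2], this forces [#|VF| >= 3] and then at least two edges. *)
have [mu_m|[mu_r v3 e2]] : mu R F = max_density R F \/
    [/\ mu R F = (#|edges F|.-1)%:R / (#|VF|.-2)%:R, (2 < #|VF|)%N & (1 < #|edges F|)%N].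
  rewrite /mu; case: eqP => [_|v2]; first by left.
  case: leP => [mr|]; last by left.
  have [e eF] := card_gt0P F1.
  have v3 : (2 < #|VF|)%N.
    rewrite ltn_neqAle eq_sym; move/eqP: v2 => -> /=.
    have := fintype.subsetP (edges_vpairs F) e eF.
    by rewrite finset.inE => /eqP <-; exact: max_card.
  right; split=> //.
    by rewrite -subn1 -subn2 natrB // natrB // ltnW.
  have := lt_le_trans m0 mr.
  rewrite pmulr_lgt0 ?subr_gt0 ?ltr1n //.
  by rewrite invr_gt0 subr_gt0 (ltr_nat _ 2).
- exists (Num.min delta 1); first by rewrite lt_min delta0 ltr01.
  move=> n p n2 p01; rewrite mu_m mE => pc.
  have n0 : (0 < n)%N by apply: leq_trans n2.
  apply: (le_trans (deviates_prob_subgraph n0 p01 WD)).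
  apply: (@le_trans _ _ (Num.min delta 1)); last by rewrite ge_min lexx.
  apply: expn_threshold pc => //; first by case/andP: p01.
  by rewrite le_min ler01 (ltW delta0) ge_min lexx orbT.
(* The cut is at [omega = 32 / delta]: below it the bound [omega * eta] needs
   [eta <= delta ^ 2 / 32]; above it [16 / omega <= delta / 2], and
   [8 * eta / eps <= delta / 2] needs [eta <= delta * eps / 16]. *)
pose c := Num.min 1 (Num.min (delta ^+ 2 / 32) (delta * eps / 16)).
have c0 : 0 < c.
  by rewrite !lt_min ltr01 !divr_gt0 ?mulr_gt0 ?exprn_gt0.
have [c1 c2 c3] : [/\ c <= 1, c <= delta ^+ 2 / 32 & c <= delta * eps / 16].
  by rewrite /c; split; rewrite !ge_min lexx ?orbT.
exists c => // n p n2 p01; rewrite mu_r => pc.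
have n0 : (0 < n)%N by apply: leq_trans n2.
have nR : 0 < n%:R :> R by rewrite ltr0n.
have /andP[p0 _] := p01.
have : n%:R ^+ #|VF|.-2 * p ^+ #|edges F|.-1 <= c.
  apply: expn_threshold pc => //; last by rewrite c1 ltW.
  - by rewrite -subn2 subn_gt0.
  - by rewrite -subn1 subn_gt0.
set eta := (X in X <= c) => eta_c.
have eta0 : 0 <= eta by rewrite mulr_ge0 // exprn_ge0 // ltW.
pose w : R := n%:R ^+ 2 * p.
have w0 : 0 <= w by rewrite mulr_ge0 // exprn_ge0 // ltW.
have EX : n%:R ^+ #|VF| * p ^+ #|edges F| = w * eta.
  have vE : (#|VF| = 2 + #|VF|.-2)%N by rewrite -subn2 subnKC // ltnW.
  have eE : (#|edges F| = 1 + #|edges F|.-1)%N by rewrite add1n prednK.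
  by rewrite [in LHS]vE [in LHS]eE !exprD expr1 /w /eta mulrACA.
have [small|large] := leP w (32 / delta).
  apply: (le_trans (deviates_prob_subgraph n0 p01 FF)).
  rewrite finset.cardsT EX.
  apply: (@le_trans _ _ (32 / delta * (delta ^+ 2 / 32))).
    by apply: ler_pM => //; exact: le_trans c2.
  by have -> // : 32 / delta * (delta ^+ 2 / 32) = delta by field; rewrite gt_eqF.
have w_gt0 : 0 < w by apply: lt_trans large; rewrite divr_gt0.
have p_gt0 : 0 < p.
  rewrite lt_def p0 andbT; apply: contraTneq w_gt0 => p_eq0.
  by rewrite /w p_eq0 mulr0 ltxx.
apply: (le_trans (deviates_prob_dense n2 p01 p_gt0)).
rewrite EX -/w.
have -> : 8 / eps * (w * eta) / w = 8 / eps * eta by field; rewrite !gt_eqF.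
have eta_eps : eta <= delta * eps / 16 := le_trans eta_c c3.
clearbody w eta; clear -delta0 eps0 w_gt0 large eta_eps.
have h1 : 16 / w <= delta / 2.
  rewrite ler_pdivrMr //; move: large; rewrite ltr_pdivrMr // => large; lra.
have h2 : 8 / eps * eta <= delta / 2.
  rewrite mulrAC ler_pdivrMr //; lra.
lra.
Qed.

End Deviation.

Theorem theorem4p2 (R : realType) (VF : finType) (F : graph VF)
  (hF : (1 <= min_degree F)%N)
  (p : nat -> R)
  (hp01 : forall n, 0 <= p n <= 1)
  (hp : much_less p (fun n => n%:R `^ (- (mu R F)^-1))) :
  forall eps : R, 0 < eps ->
    ((fun n => gnp_prob (p n) (fun G : graph 'I_n =>
        `| (wsat F G)%:R - #|edges G|%:R | <= eps * #|edges G|%:R))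
      @ \oo --> (1 : R))%classic.
Proof.
move=> eps eps0; apply/cvgrPdist_le => delta delta0.
have [c c0 small] := deviates_small eps0 (edges_gt0 hF) delta0.
move/cvgrPdist_le: hp => /(_ c c0) hp.
near=> n.
have n2 : (2 <= n)%N by near: n; exact: nbhs_infty_ge.
have n0 : 0 < n%:R `^ (- (mu R F)^-1) :> R.
  by apply: powR_gt0; rewrite ltr0n; exact: leq_trans n2.
have pc : p n <= c * n%:R `^ (- (mu R F)^-1).
  rewrite -ler_pdivrMr //; apply: le_trans (ler_norm _) _.
  by rewrite -normrN -sub0r; near: n.
rewrite gnp_probC opprB addrC subrK ger0_norm ?gnp_prob_ge0 //.
exact: small.
Unshelve. all: by end_near.
Qed.
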